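(* Let $q$ be a prime power. A tangent splash of $\ell_\infty$ in $\mathrm{PG}(2,q^3)$ has a unique centre: if a set $\mathscr{S}\subseteq\ell_\infty$ is the tangent splash of an order-$q$-subplane meeting $\ell_\infty$ exactly in $T$ and also of an order-$q$-subplane meeting $\ell_\infty$ exactly in $U$, then $T=U$.
   Context: An order-$q$-subplane of $\mathrm{PG}(2,q^3)$ is a subplane of order $q$. If $\pi$ is an order-$q$-subplane meeting the line $\ell_\infty$ in exactly one point $T$, its tangent splash is the set of $q^2+1$ points of $\ell_\infty$ lying on the extension of some line of $\pi$, and $T$ is called its centre. *)

(* Defs.v *)
From HB Require Import structures.
From mathcomp Require Import all_boot all_algebra.

Set Implicit Arguments.
Unset Strict Implicit.
Unset Printing Implicit Defensive.

(* Over a finite field there are finitely many subspaces; this makes the points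
   and the lines of PG(2, F) finTypes. *)
HB.instance Definition _ (F : finFieldType) (vT : vectType F) :
    isCountable {vspace vT} := CanIsCountable (@VectorInternalTheory.vs2mxK F vT).
HB.instance Definition _ (F : finFieldType) (vT : vectType F) :
    isFinite {vspace vT} := CanIsFinite (@VectorInternalTheory.vs2mxK F vT).

Definition pg_point (F : finFieldType) :=
  {U : {vspace 'rV[F]_3} | \dim U == 1}.
Definition pg_line (F : finFieldType) :=
  {W : {vspace 'rV[F]_3} | \dim W == 2}.

Definition pg_inc (F : finFieldType) (X : pg_point F) (l : pg_line F) : bool :=
  (val X <= val l)%VS.

Definition points_on (F : finFieldType) (l : pg_line F) : {set pg_point F} :=
  [set X | pg_inc X l].

(* The set P of points and the set L of lines, with the incidence inherited
   from I, form a projective plane. *)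
Record projective_plane (Pt Ln : finType) (I : Pt -> Ln -> bool)
    (P : {set Pt}) (L : {set Ln}) : Prop := ProjectivePlane {
  join_unique : forall X Y, X \in P -> Y \in P -> X != Y ->
    exists! l, [/\ l \in L, I X l & I Y l];
  meet_unique : forall l m, l \in L -> m \in L -> l != m ->
    exists! X, [/\ X \in P, I X l & I X m];
  quadrangle : exists Q : {set Pt}, [/\ Q \subset P, #|Q| = 4 &
    forall l, l \in L -> #|[set X in Q | I X l]| <= 2]
}.

Definition projective_plane_of_order (q : nat) (Pt Ln : finType)
    (I : Pt -> Ln -> bool) (P : {set Pt}) (L : {set Ln}) : Prop :=
  projective_plane I P L /\
  forall l, l \in L -> #|[set X in P | I X l]| = q.+1.

Definition order_subplane (q : nat) (F : finFieldType)
    (P : {set pg_point F}) (L : {set pg_line F}) : Prop :=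
  projective_plane_of_order q (@pg_inc F) P L.

Definition splash (F : finFieldType) (linf : pg_line F) (L : {set pg_line F}) :
    {set pg_point F} :=
  [set X in points_on linf | [exists l in L, pg_inc X l]].

(* S is the splash on linf of an order-q-subplane (P, L) that is tangent to
   linf at T. *)
Definition tangent_splash_at (q : nat) (F : finFieldType) (linf : pg_line F)
    (T : pg_point F) (S : {set pg_point F}) : Prop :=
  exists P : {set pg_point F}, exists L : {set pg_line F},
    [/\ order_subplane q P L,
        P :&: points_on linf = [set T] &
        S = splash linf L].

(* Main.v *)
Require Import Defs.
From mathcomp Require Import all_boot all_algebra all_field ring.

Set Implicit Arguments.
Unset Strict Implicit.
Unset Printing Implicit Defensive.

Import GRing.Theory.
Local Open Scope ring_scope.

(** Let [t] span the centre [T]. The lines of the subplane missing [T] are given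
by linear forms [f] with [f t = 1]; joining and meeting inside the subplane shows
that these forms are closed under [f + g - h]. The line of [f] meets
[linf] = <[t], [o]> in [o - f o *: t], so in the affine coordinate of [linf]
with [T] at infinity the splash minus [T] is a coset of an additive subgroup of
order [q ^ 2]. If [T] and [U] were distinct centres, taking [T] as infinity and
[U] as origin, both the subgroup [A] and its set of inverses would be closed
under addition. Then [A] is closed under [a ^+ 2 / b], hence up to scaling is a
subfield of order [q ^ 2], which a field of order [q ^ 3] does not contain. *)

(** * Sets closed under addition and under [(a^-1 + b^-1)^-1] *)

Section InverseClosed.
Variables (F : finFieldType) (W : {set F}).
Hypotheses (W1 : 1 \in W).
Hypothesis WD : {in W &, forall a b, a + b \in W}.
Hypothesis WV : {in W &, forall a b, (a^-1 + b^-1)^-1 \in W}.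

Lemma addclosed_mulrn a n : a \in W -> a *+ n.+1 \in W.
Proof. by move=> aW; elim: n => // n IHn; rewrite mulrS WD. Qed.

(** In positive characteristic [- b] is a sum of copies of [b]. *)
Lemma addclosed_sub : {in W &, forall a b, a - b \in W}.
Proof.
have [[|[|p]] // _ pF] := finPcharP F.
move=> a b aW bW; apply: WD => //.
have -> : - b = b *+ p.+1.
  by apply/eqP; rewrite eq_sym -addr_eq0 -mulrSr (mulrn_pchar pF).
exact: addclosed_mulrn.
Qed.

(* With [x = a] and [y = b - a], [(x^-1 + y^-1)^-1 = a - a ^+ 2 / b]. *)
Lemma sqr_div_closed : {in W &, forall a b, a ^+ 2 / b \in W}.
Proof.
move=> a b aW bW; have W0 : 0 \in W by rewrite -(subrr 1) addclosed_sub.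
have [->|b0] := eqVneq b 0; first by rewrite invr0 mulr0.
have [->|a0] := eqVneq a 0; first by rewrite expr0n mul0r.
have [<-|ab] := eqVneq a b; first by rewrite expr2 mulfK.
have ba0 : b - a != 0 by rewrite subr_eq0 eq_sym.
have -> : a ^+ 2 / b = a - (a^-1 + (b - a)^-1)^-1.
  by field; rewrite subrK ba0 a0.
by rewrite addclosed_sub // WV // addclosed_sub.
Qed.

(** Taking [a = 1] in [sqr_div_closed] gives inverses, hence all [a ^+ 2 * b]. In characteristic 2
    squaring permutes [W], so [a] is itself a square from [W]; otherwise expanding [(a + b) ^+ 2]
    gives [(a * b) *+ 2], which can be halved. *)
Lemma inverse_closed_mul : {in W &, forall a b, a * b \in W}.
Proof.
have Winv : {in W, forall b, b^-1 \in W}.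
  by move=> b bW; rewrite -div1r -(expr1n _ 2) sqr_div_closed.
have Wsqr : {in W &, forall a b, a ^+ 2 * b \in W}.
  by move=> a b aW bW; rewrite -[b]invrK sqr_div_closed ?Winv.
have [p p_pr pF] := finPcharP F.
move=> a b aW bW.
have [p2|p_odd] := even_prime p_pr.
  rewrite p2 in pF.
  have Wsq : {in W, forall a, a ^+ 2 \in W}.
    by move=> c cW; rewrite -[c ^+ 2]mulr1 Wsqr.
  have sq_inj : injective (fun c : F => c ^+ 2).
    by move=> c d /=; apply: (fmorph_inj (pFrobenius_aut pF)).
  have sqW : [set c ^+ 2 | c in W] = W.
    apply/eqP; rewrite eqEcard card_imset // leqnn andbT.
    by apply/subsetP => _ /imsetP[c cW ->]; apply: Wsq.
  by move: aW; rewrite -{1}sqW => /imsetP[c cW ->]; apply: Wsqr.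
have ab2 : (a * b) *+ 2 \in W.
  have -> : (a * b) *+ 2 = (a + b) ^+ 2 * 1 - a ^+ 2 * 1 - b ^+ 2 * 1 by ring.
  by rewrite !addclosed_sub // Wsqr // WD.
(* As [p] is odd, [(p./2).+1] inverts 2 modulo [p]. *)
have -> : a * b = a * b *+ 2 *+ (p./2).+1.
  have p_half : p./2.*2.+1 = p by rewrite -[RHS]odd_double_half p_odd.
  by rewrite -mulrnA mul2n doubleS p_half mulrSr (mulrn_pchar pF) add0r.
exact: addclosed_mulrn.
Qed.
End InverseClosed.

(** Fermat's argument: multiplication by [x != 0] permutes [W :\ 0], so it preserves the product of
    that set. *)
Lemma expf_card_mul_closed (F : finFieldType) (W : {set F}) :
  0 \in W -> {in W &, forall a b, a * b \in W} ->
  {in W, forall x, x ^+ #|W| = x}.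
Proof.
move=> W0 WM x xW; have [->|x0] := eqVneq x 0.
  by rewrite expr0n; rewrite (cardsD1 0 W) W0.
rewrite (cardsD1 0 W) W0 add1n exprS -[RHS]mulr1; congr (_ * _).
have xmul_inj : injective ( *%R x) by exact: mulfI.
have xW' : [set x * c | c in W :\ 0] = W :\ 0.
  apply/eqP; rewrite eqEcard card_imset // leqnn andbT.
  apply/subsetP => _ /imsetP[c /setD1P[c0 cW] ->].
  by rewrite !inE mulf_neq0 //= WM.
have prod0 : \prod_(c in W :\ 0) c != 0.
  by apply/prodf_neq0 => c /setD1P[].
apply: (mulIf prod0); rewrite mul1r -[in RHS]xW' big_imset /=; last exact: in2W.
by rewrite big_split /= prodr_const.
Qed.

(** Raising [x = x ^+ (q ^ 2)] to the power [q] gives [x ^+ q = x ^+ (q ^ 3) = x] on [W], but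
    ['X^q - 'X] has at most [q] roots. *)
Lemma no_subfield_sqr (F : finFieldType) (W : {set F}) q :
  (1 < q)%N -> #|F| = (q ^ 3)%N -> #|W| = (q ^ 2)%N -> 0 \in W ->
  ~ {in W &, forall a b, a * b \in W}.
Proof.
move=> q1 cF cW W0 WM.
have Wq x : x \in W -> x ^+ q = x.
  move=> xW; have := expf_card_mul_closed W0 WM xW; rewrite cW => xq2.
  by rewrite -{1}xq2 -exprM -expnSr -cF expf_card.
have sz : size ('X^q - 'X : {poly F}) = q.+1.
  by rewrite size_polyDl size_polyXn // size_polyN size_polyX ltnS.
have p0 : ('X^q - 'X : {poly F}) != 0 by rewrite -size_poly_eq0 sz.
have := max_poly_roots p0 (rs := enum W); rewrite enum_uniq -cardE cW sz ltnS.
have -> : all (root ('X^q - 'X)) (enum W).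
  apply/allP => x; rewrite mem_enum => /Wq xq.
  by rewrite rootE !hornerE xq subrr.
move=> /(_ isT isT); rewrite leqNgt => /negP; apply.
by rewrite -{1}[q]expn1 ltn_exp2l.
Qed.

(** Both operations commute with scaling, so dividing [W] by one of its nonzero elements brings 1
    into it and keeps the closure. *)
Lemma no_inverse_closed_sqr (F : finFieldType) (W : {set F}) q :
  (1 < q)%N -> #|F| = (q ^ 3)%N -> #|W| = (q ^ 2)%N -> 0 \in W ->
  {in W &, forall a b, a + b \in W} ->
  ~ {in W &, forall a b, (a^-1 + b^-1)^-1 \in W}.
Proof.
move=> q1 cF cW W0 WD WV.
have [w /setD1P[w0 wW]] : exists w, w \in W :\ 0.
  apply/card_gt0P; rewrite -(leq_add2l (0 \in W)) -cardsD1 cW W0.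
  by rewrite (@ltn_exp2l q 0 2).
pose W' := [set x | w * x \in W].
have cW' : #|W'| = (q ^ 2)%N.
  rewrite -cW -(@card_imset _ _ ( *%R w) W'); last exact: mulfI.
  apply: eq_card => x; apply/imsetP/idP => [[y + ->]|xW]; first by rewrite inE.
  by exists (w^-1 * x); rewrite ?inE mulrA divff ?mul1r.
apply: (no_subfield_sqr q1 cF cW'); first by rewrite inE mulr0.
apply: inverse_closed_mul => [|a b|a b]; rewrite !inE ?mulr1 //.
  by rewrite mulrDr; apply: WD.
by move=> aW bW; have := WV _ _ aW bW; rewrite !invfM -mulrDr invfM invrK.
Qed.

(** * Incidence and counting in a plane of order [q] *)

Section PlaneOfOrder.
Variables (q : nat) (Pt Ln : finType) (I : Pt -> Ln -> bool).
Variables (P : {set Pt}) (L : {set Ln}).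
Hypothesis plane : projective_plane_of_order q I P L.

Lemma plane_join X Y : X \in P -> Y \in P -> X != Y ->
  exists l, [/\ l \in L, I X l & I Y l].
Proof.
move=> XP YP XY; have [l [lL _]] := join_unique plane.1 XP YP XY.
by exists l.
Qed.

Lemma plane_meet l m : l \in L -> m \in L -> l != m ->
  exists X, [/\ X \in P, I X l & I X m].
Proof.
move=> lL mL lm; have [X [XP _]] := meet_unique plane.1 lL mL lm.
by exists X.
Qed.

Lemma plane_line_eq X Y l m : X \in P -> Y \in P -> X != Y ->
  l \in L -> m \in L -> I X l -> I Y l -> I X m -> I Y m -> l = m.
Proof.
move=> XP YP XY lL mL Xl Yl Xm Ym.
have [n [_ nE]] := join_unique plane.1 XP YP XY.
by rewrite -(nE l) // -(nE m).
Qed.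

Lemma plane_point_neq T : exists2 X, X \in P & X != T.
Proof.
have [Q [/subsetP QP cQ _]] := quadrangle plane.1.
have [X /setD1P[XT /QP XP]] : exists X, X \in Q :\ T; last by exists X.
apply/card_gt0P; rewrite -(ltn_add2l (T \in Q)) -cardsD1 cQ addn0.
exact: leq_ltn_trans (leq_b1 _) _.
Qed.

Lemma plane_point_off l : l \in L -> exists2 X, X \in P & ~~ I X l.
Proof.
have [Q [/subsetP QP cQ Ql]] := quadrangle plane.1.
move=> /Ql; case: (set_0Vmem (Q :\: [set X in Q | I X l])) => [Q0|].
  suff -> : [set X in Q | I X l] = Q by rewrite cQ.
  apply/eqP; rewrite eqEsubset -setD_eq0 -(setD_eq0 Q) Q0 eqxx andbT.
  by apply/eqP/setP => X; rewrite !inE; case: (X \in Q).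
by case=> X; rewrite !inE => /andP[+ XQ]; rewrite XQ => Xl; exists X; rewrite ?QP.
Qed.

Lemma card_line_rem l T : l \in L -> T \in P -> I T l ->
  #|[set X in P | I X l] :\ T| = q.
Proof.
move=> lL TP Tl; apply/eqP.
by rewrite -eqSS -(plane.2 _ lL) (cardsD1 T [set X in P | I X l]) inE TP Tl.
Qed.

(** Join a third point [Z] of the line through [X] and [T] to a point [Y] off that line. *)
Lemma plane_line_avoid T X : (1 < q)%N -> T \in P -> X \in P -> X != T ->
  exists l, [/\ l \in L, ~~ I T l & ~~ I X l].
Proof.
move=> q1 TP XP XT; have [m [mL Xm Tm]] := plane_join XP TP XT.
have [Y YP Ym] := plane_point_off mL.
have [Z] : exists Z, Z \in ([set X in P | I X m] :\ T) :\ X.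
  apply/card_gt0P; rewrite -(ltn_add2l 1) addn0.
  rewrite -(card_line_rem mL TP Tm) (cardsD1 X) in q1.
  by move: q1; case: (X \in _) => //= /ltnW.
rewrite !inE => /and4P[ZX ZT ZP Zm].
have ZY : Z != Y by apply: contraNneq Ym => <-.
have [l [lL Zl Yl]] := plane_join ZP YP ZY.
exists l; split=> //; apply: contra Ym => Al.
  by rewrite (plane_line_eq ZP TP ZT mL lL).
by rewrite (plane_line_eq ZP XP ZX mL lL).
Qed.

(* Fixing two lines through [T], a line missing [T] is determined by the pair
   of points in which it meets them. *)
Lemma card_lines_avoid T : T \in P -> #|[set l in L | ~~ I T l]| = (q ^ 2)%N.
Proof.
move=> TP; have [X XP XT] := plane_point_neq T.
have [m1 [m1L Xm1 Tm1]] := plane_join XP TP XT.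
have [Y YP Ym1] := plane_point_off m1L.
have YT : Y != T by apply: contraNneq Ym1 => ->.
have [m2 [m2L Ym2 Tm2]] := plane_join YP TP YT.
have m12 : m1 != m2 by apply: contraNneq Ym1 => ->.
have TmE A m l : A \in P -> A != T -> m \in L -> l \in L -> I T m -> I T l ->
  I A m -> I A l -> m = l by move=> AP AT mL lL *; apply: (plane_line_eq AP TP).
pose D := setX ([set X in P | I X m1] :\ T) ([set X in P | I X m2] :\ T).
(* The default [m1] is never taken on [D]: a point of [m1] and a point of [m2], both other than [T],
   are distinct and so have a join. *)
pose join A := odflt m1 [pick l in L | I A.1 l && I A.2 l].
have joinP A : A \in D -> [/\ join A \in L, I A.1 (join A) & I A.2 (join A)].
  case: A => A B; rewrite !inE /= => /andP[/and3P[AT AP Am1] /and3P[BT BP Bm2]].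
  rewrite /join; case: pickP => [l /and3P[] //|noline] /=.
  have AB : A != B.
    by apply: contraNneq m12 => AB; apply/eqP; apply: (TmE A); rewrite // AB.
  by have [l [lL Al Bl]] := plane_join AP BP AB; have := noline l; rewrite /= lL Al Bl.
have -> : [set l in L | ~~ I T l] = join @: D.
  apply/setP => l; apply/idP/imsetP => [|[[A B] ABD ->]].
    rewrite inE => /andP[lL Tl].
    have lm m : I T m -> l != m by move=> Tm; apply: contraNneq Tl => ->.
    have lT A : I A l -> A != T by move=> Al; apply: contraNneq Tl => <-.
    have [A [AP Al Am1]] := plane_meet lL m1L (lm _ Tm1).
    have [B [BP Bl Bm2]] := plane_meet lL m2L (lm _ Tm2).
    have ABD : (A, B) \in D by rewrite !inE /= !lT ?AP ?BP ?Am1 ?Bm2.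
    exists (A, B) => //; have [jL Aj Bj] := joinP _ ABD.
    apply: (plane_line_eq AP BP) => //.
    by apply: contraNneq m12 => AB; apply/eqP; apply: (TmE A); rewrite // ?lT // AB.
  have [jL /= Aj Bj] := joinP _ ABD; rewrite inE jL /=.
  move: ABD; rewrite !inE /= => /andP[/and3P[AT AP Am1] /and3P[BT BP Bm2]].
  apply: contra m12 => Tj; apply/eqP.
  by rewrite (TmE A m1 (join (A, B))) // (TmE B m2 (join (A, B))).
rewrite card_in_imset ?cardsX ?card_line_rem //.
move=> [A B] [A' B'] ABD ABD' jE; have [jL /= Aj Bj] := joinP _ ABD.
have [_ /=] := joinP _ ABD'; rewrite -jE => Aj' Bj'.
move: ABD ABD'; rewrite !inE /= => /andP[/and3P[AT AP Am1] /and3P[BT BP Bm2]].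
case/andP=> /and3P[AT' AP' Am1'] /and3P[BT' BP' Bm2'].
(* Two distinct points on [m1] would make the join equal to [m1], which would then share [B] and [T]
   with [m2]; likewise with the roles exchanged. *)
congr (_, _); apply/eqP; apply: contraNT m12 => neq; apply/eqP.
  have jm1 : join (A, B) = m1 by apply: (plane_line_eq AP AP' neq).
  by apply: (TmE B); rewrite // -jm1.
have jm2 : join (A, B) = m2 by apply: (plane_line_eq BP BP' neq).
by apply: (TmE A); rewrite // -jm2.
Qed.
End PlaneOfOrder.

(** * Subspaces of 3-space and normalised linear forms *)

Section ThreeSpace.
Variable F : finFieldType.
Local Notation V3 := 'rV[F]_3.
Implicit Types (U W : {vspace V3}) (x y z t : V3) (f g h : 'Hom(V3, F^o)).

Lemma pg_point_vline (X : pg_point F) :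
  exists2 x, x != 0 & val X = <[x]>%VS.
Proof.
have /eqP dX := valP X; have x0 : vpick (val X) != 0.
  by rewrite vpick0 -dimv_eq0 dX.
exists (vpick (val X)) => //; apply/eqP.
by rewrite eq_sym eqEdim -memvE memv_pick dX dim_vline x0.
Qed.

Lemma pg_point_of x : x != 0 -> exists X : pg_point F, val X = <[x]>%VS.
Proof.
move=> x0; have dx : \dim <[x]> == 1%N by rewrite dim_vline x0.
by exists (exist _ <[x]>%VS dx).
Qed.

Lemma vline_scale a x : a != 0 -> <[a *: x]>%VS = <[x]>%VS.
Proof.
move=> a0; apply/eqP; rewrite eqEsubv -(memvE (a *: x)) -(memvE x).
by rewrite memvZ ?memv_line // -{1}(scalerK a0 x) memvZ ?memv_line.
Qed.

Lemma dimv2_span U x y : \dim U = 2 -> x != 0 -> y \notin <[x]>%VS ->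
  x \in U -> y \in U -> U = (<[x]> + <[y]>)%VS.
Proof.
move=> dU x0 yx xU yU; apply/eqP; rewrite eq_sym eqEdim.
rewrite -[X in (X <= _)%VS]/(<[x]> + <[y]>)%VS subv_add -!memvE xU yU /=.
have : free [:: y; x] by rewrite free_cons span_seq1 yx seq1_free.
by rewrite dU /free span_cons span_seq1 addvC => /eqP->.
Qed.

Lemma formBZ f x a y : f (x - a *: y) = f x - a * f y.
Proof. by rewrite linearB linearZ. Qed.

Lemma dim_lker_form f t : f t != 0 -> \dim (lker f) = 2.
Proof.
move=> ft; have := limg_ker_dim f fullv; rewrite capfv dimvf.
suff -> : \dim (limg f) = 1%N by rewrite addn1 => -[].
apply/eqP; rewrite eqn_leq lt0n dimv_eq0 -[X in (_ <= X)%N](dimvf F^o).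
rewrite dimvS ?subvf //=; apply: contraNneq ft => f0.
by rewrite -memv0 -f0 memv_img ?memvf.
Qed.

Lemma form_of_dim2 U t : \dim U = 2 -> t \notin U ->
  exists2 f : 'Hom(V3, F^o), f t = 1 & lker f = U.
Proof.
move=> dU tU; have t0 : t != 0 by apply: contraNneq tU => ->; rewrite mem0v.
have tU0 : (<[t]> :&: U = 0)%VS.
  apply/eqP; rewrite -subv0; apply/subvP => v /memv_capP[/vlineP[a ->] atU].
  have [->|a0] := eqVneq a 0; first by rewrite scale0r mem0v.
  by case/negP: tU; rewrite -(scalerK a0 t) memvZ.
(* The coordinate along [t] of the projection with kernel [U]. *)
pose f : 'Hom(V3, F^o) := linfun ((coord [tuple t] ord0 : V3 -> F^o) \o daddv_pi <[t]> U).
have ft : f t = 1.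
  rewrite lfunE /= daddv_pi_id ?memv_line //.
  have := @coord_free _ _ _ [tuple t] ord0 ord0; rewrite /= => -> //.
  by rewrite seq1_free.
exists f => //; apply/eqP.
rewrite eq_sym eqEdim dU (dim_lker_form (t := t)) ?ft ?oner_eq0 // andbT.
apply/subvP => v vU; rewrite memv_ker lfunE /=.
have Ut0 : (U :&: <[t]> = 0)%VS by rewrite capvC.
have := daddv_pi_add tU0 (subvP (addvSr <[t]> U) v vU).
rewrite (daddv_pi_id Ut0 vU) => /(canRL (addrK _)) ->.
by rewrite subrr linear0.
Qed.

(** The vector [v - f v *: t] lies in the common kernel. *)
Lemma form_ker_inj t f g : f t = 1 -> g t = 1 -> lker f = lker g -> f = g.
Proof.
move=> ft gt fg; apply/lfunP => v; apply/eqP; rewrite eq_sym -subr_eq0.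
have : v - f v *: t \in lker g.
  by rewrite -fg memv_ker formBZ ft mulr1 subrr.
by rewrite memv_ker formBZ gt mulr1.
Qed.
End ThreeSpace.

(** * Equations of the subplane lines that miss a given point *)

Section TangentSubplane.
Variables (q : nat) (F : finFieldType).
Variables (P : {set pg_point F}) (L : {set pg_line F}).
Hypothesis plane : order_subplane q P L.
Hypothesis q_gt1 : (1 < q)%N.
Local Notation V3 := 'rV[F]_3.
Implicit Types (x y z o : V3) (f g h k : 'Hom(V3, F^o)).

(** Points are replaced by representing vectors, on which linear forms can be evaluated. *)
Definition subplane_vec x := [exists X in P, val X == <[x]>%VS].

Lemma subplane_vecP x :
  reflect (exists2 X, X \in P & val X = <[x]>%VS) (subplane_vec x).
Proof.
apply: (iffP exists_inP) => -[X XP /eqP]; last by exists X => //; apply/eqP.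
by move=> ?; exists X; rewrite // -(eqP (valP X)).
Qed.

Lemma subplane_vec_neq0 x : subplane_vec x -> x != 0.
Proof.
by case/subplane_vecP=> X _ XE; have := valP X; rewrite XE dim_vline eqb1.
Qed.

Lemma subplane_vec_join x y : subplane_vec x -> subplane_vec y ->
  y \notin <[x]>%VS -> exists l, [/\ l \in L, x \in val l & y \in val l].
Proof.
move=> /subplane_vecP[X XP XE] /subplane_vecP[Y YP YE] yx.
have XY : X != Y.
  by apply: contraNneq yx => XY; rewrite -XE XY YE memv_line.
have [l [lL Xl Yl]] := plane_join plane XP YP XY.
by exists l; rewrite !memvE -XE -YE.
Qed.

Lemma subplane_vec_meet l m : l \in L -> m \in L -> l != m ->
  exists x, [/\ subplane_vec x, x \in val l & x \in val m].
Proof.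
move=> lL mL lm; have [X [XP Xl Xm]] := plane_meet plane lL mL lm.
have [x x0 XE] := pg_point_vline X.
by exists x; rewrite !memvE -XE; split=> //; apply/subplane_vecP; exists X.
Qed.

Variable t : V3.
Hypothesis Pt : subplane_vec t.

(* The lines of the subplane that miss [<[t]>], each as its unique equation
   [f = 0] normalised by [f t = 1]. *)
Definition line_form f := f t = 1 /\ exists2 l, l \in L & val l = lker f.

Lemma line_form_meet f g : line_form f -> line_form g -> f <> g ->
  exists x, [/\ subplane_vec x, f x = 0 & g x = 0].
Proof.
move=> [ft [l lL lE]] [gt [m mL mE]] fg.
have lm : l != m.
  by apply: contra_notN fg => /eqP lm; rewrite (form_ker_inj ft gt) // -lE -mE lm.
have [x [Px]] := subplane_vec_meet lL mL lm.
by rewrite lE mE !memv_ker => /eqP fx /eqP gx; exists x.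
Qed.

Lemma line_form_neq0 f : line_form f -> f t != 0.
Proof. by case=> -> _; rewrite oner_eq0. Qed.

Lemma line_form_avoid x : subplane_vec x -> x \notin <[t]>%VS ->
  exists2 f, line_form f & f x != 0.
Proof.
case/subplane_vecP: Pt => T TP TE /subplane_vecP[X XP XE] xt.
have XT : X != T.
  by apply: contraNneq xt => XT; rewrite -TE -XT XE memv_line.
have [l [lL Tl Xl]] := plane_line_avoid plane q_gt1 TP XP XT.
have [|f ft fE] := @form_of_dim2 _ (val l) t (eqP (valP l)).
  by rewrite memvE -TE.
by exists f; [split=> //; exists l | rewrite -memv_ker fE memvE -XE].
Qed.

(* The line joining [<[t]>] and [<[x]>] meets [g = 0] in [x - g x *: t]. *)
Lemma subplane_vec_proj g x : line_form g -> subplane_vec x ->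
  x \notin <[t]>%VS -> subplane_vec (x - g x *: t).
Proof.
move=> gL Px xt; have [gt [l lL lE]] := gL.
have [m [mL tm xm]] := subplane_vec_join Pt Px xt.
have lm : l != m.
  apply: contraTneq tm => <-; rewrite lE memv_ker; exact: line_form_neq0.
have [z [Pz]] := subplane_vec_meet lL mL lm.
have t0 := subplane_vec_neq0 Pt.
rewrite lE memv_ker (dimv2_span (eqP (valP m)) t0 xt tm xm) => /eqP gz.
case/memv_addP=> _ /vlineP[a ->] [_ /vlineP[b ->] zE].
(* The meeting point is [z = a *: t + b *: x]; [g z = 0] determines [a], and [z != 0] then forces
   [b != 0]. *)
have aE : a = - (b *: g x).
  apply/eqP; rewrite -addr_eq0 -gz zE linearD !linearZ /= gt.
  by rewrite -[a *: _]/(a * _) mulr1.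
have zE' : z = b *: (x - g x *: t).
  by rewrite zE aE scalerBr scalerA scaleNr addrC.
have b0 : b != 0.
  by apply: contraTneq (subplane_vec_neq0 Pz) => b0; rewrite zE' b0 scale0r eqxx.
case/subplane_vecP: Pz => Z ZP ZE; apply/subplane_vecP; exists Z => //.
by rewrite ZE zE' vline_scale.
Qed.

(** Let [y] be the common point of [h] and [g]. Projecting from [t], [x] goes to [x'] on [g] and [y]
    to [y'] on [f]. The form [f + g - h] vanishes at [x'] and [y'], so its kernel is their join. *)
Lemma line_form_parallelogram h f g x :
  line_form h -> line_form f -> line_form g -> subplane_vec x ->
  h x = 0 -> f x = 0 -> g x != 0 -> line_form (f + g - h).
Proof.
move=> hL fL gL Px hx fx gx.
have [ht _] := hL; have [ft _] := fL; have [gt _] := gL.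
have hg : h <> g by move=> hg; rewrite -hg hx eqxx in gx.
have [y [Py hy gy]] := line_form_meet hL gL hg.
have off_t z : z != 0 -> h z = 0 -> z \notin <[t]>%VS.
  move=> z0 hz; apply: contraNN z0 => /vlineP[a zE]; move: hz.
  by rewrite zE linearZ /= ht -[_ *: _]/(_ * _) mulr1 => ->; rewrite scale0r.
have xt := off_t _ (subplane_vec_neq0 Px) hx.
have yt := off_t _ (subplane_vec_neq0 Py) hy.
pose x' := x - g x *: t; pose y' := y - f y *: t.
have Px' : subplane_vec x' by apply: subplane_vec_proj.
have Py' : subplane_vec y' by apply: subplane_vec_proj.
have y'x' : y' \notin <[x']>%VS.
  (* If [y' = c *: x'], applying [h] gives [f y = c * g x], hence [y = c *: x]; then [g y = 0]
     forces [c = 0] and [y = 0]. *)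
  apply/vlineP => -[c y'E]; have := congr1 h y'E.
  rewrite linearZ /= !formBZ hx hy ht !mulr1 !sub0r -[c *: _]/(c * _) mulrN.
  move/oppr_inj => fy.
  move: y'E; rewrite /y' /x' scalerBr scalerA fy => /(addIr _) yE.
  move: gy; rewrite yE linearZ /= => /eqP; rewrite mulf_eq0 (negPf gx) orbF.
  by move/eqP=> c0; have := subplane_vec_neq0 Py; rewrite yE c0 scale0r eqxx.
have [l [lL x'l y'l]] := subplane_vec_join Px' Py' y'x'.
have nt : (f + g - h) t = 1 by rewrite !add_lfunE !opp_lfunE ft gt ht addrK.
split=> //; exists l => //.
have x'0 := subplane_vec_neq0 Px'.
have dn : \dim (lker (f + g - h)) = 2.
  by apply: (dim_lker_form (t := t)); rewrite nt oner_eq0.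
rewrite (dimv2_span (eqP (valP l)) x'0 y'x') // (dimv2_span dn x'0 y'x') //.
  rewrite memv_ker !add_lfunE !opp_lfunE !formBZ hx fx gt ht ft.
  by apply/eqP; ring.
rewrite memv_ker !add_lfunE !opp_lfunE !formBZ hy gy gt ht ft.
by apply/eqP; ring.
Qed.

(* If [f], [g] and [h] are concurrent, detour through a line [k] that avoids
   their common point. *)
Lemma line_form_closed f g h : line_form f -> line_form g -> line_form h ->
  line_form (f + g - h).
Proof.
move=> fL gL hL; have [ft _] := fL; have [ht _] := hL.
have [->|/eqP hf] := eqVneq h f; first by rewrite addrC addKr.
have [x [Px hx fx]] := line_form_meet hL fL hf.
have [gx|gx] := eqVneq (g x) 0; last exact: (line_form_parallelogram (x := x)).
have x0 := subplane_vec_neq0 Px.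
have xt : x \notin <[t]>%VS.
  apply: contraNN x0 => /vlineP[a xE]; move: hx.
  by rewrite xE linearZ /= ht -[_ *: _]/(_ * _) mulr1 => ->; rewrite scale0r.
have [k kL kx] := line_form_avoid Px xt; have [kt _] := kL.
have fkL : line_form (f + k - h) by apply: (line_form_parallelogram (x := x)).
have fkx : (f + k - h) x = k x.
  by rewrite !add_lfunE !opp_lfunE fx hx add0r subr0.
(* Now [h] and [g] meet in [x], where [f + k - h] does not vanish. *)
have eL : line_form (g + (f + k - h) - h).
  by apply: (line_form_parallelogram (x := x)); rewrite ?fkx.
(* The target is [e + h - k], a parallelogram based at [k]; it remains to find a common zero of [k]
   and [e] at which [h] is nonzero. *)
set e := g + _ - h in eL; have [et _] := eL.
have eE : f + g - h = e - k + h.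
  by apply/lfunP => v; rewrite /e !add_lfunE !opp_lfunE; ring.
have [ek|/eqP ke] := eqVneq k e; first by rewrite eE -ek subrr add0r.
have [z [Pz kz ez]] := line_form_meet kL eL ke.
have [hz|hz] := eqVneq (h z) 0; last first.
  by rewrite eE addrAC; apply: (line_form_parallelogram (x := z)).
(* If [h z = 0], then [x] and [z] span the kernel of [h] and, with [t], the whole space. The forms
   [k] and [e] agree on all three vectors, contradicting [k <> e]. *)
case: ke; apply/lfunP => v.
have zx : z \notin <[x]>%VS.
  apply: contraNN (subplane_vec_neq0 Pz) => /vlineP[a zE]; move: kz.
  rewrite zE linearZ /= => /eqP; rewrite mulf_eq0 (negPf kx) orbF => /eqP->.
  by rewrite scale0r.
have ex : e x = k x by rewrite /e 2!add_lfunE opp_lfunE fkx gx hx add0r subr0.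
have : v - h v *: t \in lker h.
  by rewrite memv_ker formBZ ht mulr1 subrr.
have dh := dim_lker_form (line_form_neq0 hL).
rewrite (dimv2_span dh x0 zx) ?memv_ker ?hx ?hz //.
case/memv_addP=> _ /vlineP[a ->] [_ /vlineP[b ->]] /(canRL (subrK _)) vE.
have dE (d : 'Hom(V3, F^o)) : d v = a * d x + b * d z + h v * d t.
  by rewrite {1}vE !linearD !linearZ.
by rewrite (dE k) (dE e) kz ez ex kt et.
Qed.
End TangentSubplane.

(** * The splash in an affine coordinate *)

(** Here [c] is the coordinate of the point [<[o + c *: t]>], so [T] itself is at infinity and
    contributes nothing to [A]. A line with form [f] has coordinate [- f o], which carries closure
    over from forms to [A]. *)
Lemma tangent_splash_additive (q : nat) (F : finFieldType) (linf : pg_line F)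
    (T : pg_point F) (S : {set pg_point F}) (t o : 'rV[F]_3)
    (A := [set c | [exists X in S, o + c *: t \in val X]]) :
  (1 < q)%N -> tangent_splash_at q linf T S -> val T = <[t]>%VS ->
  o \in val linf -> o \notin <[t]>%VS ->
  #|A| = (q ^ 2)%N /\ {in A & &, forall a b c, a + b - c \in A}.
Proof.
move=> q_gt1 [P [L [plane PT SE]]] TE oinf ot.
have /setIP[TP] : T \in P :&: points_on linf by rewrite PT set11.
rewrite inE /pg_inc TE -memvE => tinf.
have Pt : subplane_vec P t by apply/subplane_vecP; exists T.
have t0 := subplane_vec_neq0 Pt.
have oct0 c : o + c *: t \notin <[t]>%VS.
  by apply: contra ot; rewrite rpredDr // memvZ ?memv_line.
have octinf c : o + c *: t \in val linf by rewrite memvD ?memvZ.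
have linfL : linf \notin L.
  apply/negP => linfL; have := plane.2 _ linfL.
  rewrite (_ : [set X in P | _] = [set T]) ?cards1.
    by case => q1; rewrite -q1 in q_gt1.
  by rewrite -PT; apply/setP => X; rewrite !inE.
pose L' := [set l in L | ~~ pg_inc T l].
have AP c : reflect (exists2 l, l \in L' & o + c *: t \in val l) (c \in A).
  rewrite inE SE; apply: (iffP exists_inP) => [[X]|[l]].
    rewrite !inE => /andP[_ /exists_inP[l lL Xl]] octX.
    have octl : o + c *: t \in val l := subvP Xl _ octX.
    exists l; rewrite // inE lL; apply: contra linfL.
    rewrite /pg_inc TE -memvE => tl; rewrite (_ : linf = l) //.
    apply: val_inj => /=; rewrite (dimv2_span (eqP (valP l)) t0 (oct0 c)) //.
    by rewrite (dimv2_span (eqP (valP linf)) t0 (oct0 c)).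
  rewrite inE => /andP[lL Tl] octl.
  have [|X XE] := @pg_point_of _ (o + c *: t).
    by apply: contraNneq (oct0 c) => ->; rewrite mem0v.
  exists X; last by rewrite XE memv_line.
  rewrite !inE /pg_inc XE -memvE octinf /=.
  by apply/exists_inP; exists l; rewrite // -memvE.
have AfP c : c \in A <-> exists2 f, line_form L t f & f o = - c.
  split=> [/AP[l]|[f [ft [l lL lE]] fo]].
    rewrite inE /pg_inc TE -memvE => /andP[lL tl].
    have [f ft fE] := form_of_dim2 (eqP (valP l)) tl.
    rewrite -fE memv_ker linearD linearZ /= ft -[_ *: _]/(_ * _) mulr1.
    by rewrite addr_eq0 => /eqP foc; exists f => //; split=> //; exists l.
  apply/AP; exists l.
    by rewrite inE lL /pg_inc TE -memvE lE memv_ker ft oner_eq0.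
  by rewrite lE memv_ker linearD linearZ /= ft fo -[_ *: _]/(_ * _) mulr1 addNr.
split; last first.
  move=> a b c /AfP[f fL fo] /AfP[g gL go] /AfP[h hL ho]; apply/AfP.
  exists (f + g - h); first exact: (line_form_closed plane).
  by rewrite !add_lfunE !opp_lfunE fo go ho; ring.
rewrite -(card_lines_avoid plane TP) -/L'.
have coordP l : l \in L' -> exists c, o + c *: t \in val l.
  rewrite inE /pg_inc TE -memvE => /andP[lL tl].
  have [f ft fE] := form_of_dim2 (eqP (valP l)) tl; exists (- f o).
  by rewrite -fE memv_ker linearD linearZ /= ft -[_ *: _]/(_ * _) mulr1 subrr.
(* By [coordP] the default 0 is never taken on [L']. *)
pose coord (l : pg_line F) := odflt 0 [pick c | o + c *: t \in val l].
have coordE l : l \in L' -> o + coord l *: t \in val l.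
  move=> /coordP[c cl]; rewrite /coord.
  by case: pickP => [//|/(_ c)]; rewrite cl.
have -> : A = coord @: L'.
  apply/setP => c; apply/AP/imsetP => [[l lL' cl]|[l lL' ->]]; last first.
    by exists l => //; apply: coordE.
  exists l => //; apply/eqP; rewrite -subr_eq0.
  have tl : t \notin val l by move: lL'; rewrite inE /pg_inc TE -memvE => /andP[].
  have := memvB cl (coordE l lL'); rewrite opprD addrACA subrr add0r -scalerBl.
  move=> ctl; apply: contraNT tl => c0.
  by rewrite -(scalerK c0 t) memvZ.
(* Distinct lines with the same coordinate would meet on [linf] in a subplane point. By tangency
   this is [T], which they avoid. *)
rewrite card_in_imset // => l m lL' mL' lm; apply/eqP/negPn/negP => neq_lm.
have := coordE _ mL'; have := coordE _ lL'; rewrite -lm.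
set x := o + _ => xl xm.
move: lL' mL'; rewrite !inE => /andP[lL Tl] /andP[mL _].
have [z [Pz zl zm]] := subplane_vec_meet plane lL mL neq_lm.
have x0 : x != 0 by apply: contraNneq (oct0 (coord l)) => x0; rewrite -/x x0 mem0v.
have xz : z \in <[x]>%VS.
  apply: contraNT neq_lm => zx; apply/eqP/val_inj.
  by rewrite /= (dimv2_span (eqP (valP l)) x0 zx) // (dimv2_span (eqP (valP m)) x0 zx).
have [Z ZP ZE] := subplane_vecP _ _ Pz.
have : Z \in P :&: points_on linf.
  rewrite !inE ZP /pg_inc ZE -memvE; case/vlineP: xz => a ->.
  by rewrite memvZ ?octinf.
by rewrite PT inE => /eqP ZT; rewrite -ZT /pg_inc ZE -memvE zl in Tl.
Qed.

(** * Comparison of two centres *)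

Lemma centre_in_tangent_splash (q : nat) (F : finFieldType) (linf : pg_line F)
    (T : pg_point F) (S : {set pg_point F}) :
  tangent_splash_at q linf T S -> T \in S /\ pg_inc T linf.
Proof.
move=> [P [L [plane PT ->]]].
have /setIP[TP Tinf] : T \in P :&: points_on linf by rewrite PT set11.
have [X XP XT] := plane_point_neq plane T.
have [l [lL _ Tl]] := plane_join plane XP TP XT.
rewrite !inE in Tinf *; split=> //.
by rewrite Tinf; apply/exists_inP; exists l.
Qed.

Local Close Scope ring_scope.

Theorem theorem7p2 (p h q : nat) (hp : prime p) (hh : 0 < h) (hq : q = p ^ h)
    (F : finFieldType) (hF : #|F| = q ^ 3) (linf : pg_line F)
    (S : {set pg_point F}) (hS : S \subset points_on linf) (T U : pg_point F)
    (hT : tangent_splash_at q linf T S) (hU : tangent_splash_at q linf U S) :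
  T = U.
Proof.
have q_gt1 : 1 < q by rewrite hq -(exp1n h) ltn_exp2r ?prime_gt1.
have [TS Tinf] := centre_in_tangent_splash hT.
have [US Uinf] := centre_in_tangent_splash hU.
apply/eqP/negPn/negP => TU.
have [t t0 TE] := pg_point_vline T; have [u u0 UE] := pg_point_vline U.
have vline_notin (X Y : pg_point F) x y : X != Y -> val X = <[x]>%VS ->
    val Y = <[y]>%VS -> y \notin <[x]>%VS.
  move=> XY XE YE; apply: contra XY => yx; apply/eqP/val_inj/eqP => /=.
  by rewrite eq_sym eqEdim (eqP (valP X)) (eqP (valP Y)) XE YE -memvE yx.
have ut := vline_notin _ _ _ _ TU TE UE.
have tu := vline_notin U T u t; rewrite eq_sym TU in tu; have {}tu := tu isT UE TE.
have tinf : t \in val linf by rewrite memvE -TE.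
have uinf : u \in val linf by rewrite memvE -UE.
(* [A] has [T] at infinity and [U] at 0; [B] exchanges the two. *)
have [cA AD] := tangent_splash_additive q_gt1 hT TE uinf ut.
have [_ BD] := tangent_splash_additive q_gt1 hU UE tinf tu.
set A := [set c | _] in cA AD; set B := [set c | _] in BD.
have A0 : 0%R \in A.
  rewrite inE; apply/exists_inP; exists U => //.
  by rewrite scale0r addr0 UE memv_line.
have B0 : 0%R \in B.
  rewrite inE; apply/exists_inP; exists T => //.
  by rewrite scale0r addr0 TE memv_line.
(* Exchanging the centres inverts the coordinate; with [0^-1 = 0] this also holds at 0, since both
   centres lie in [S]. *)
have AB c : (c^-1 \in B)%R = (c \in A).
  have [->|c0] := eqVneq c 0%R; first by rewrite invr0 A0 B0.
  rewrite !inE; apply: eq_existsb => X; congr (_ && _).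
  have -> : (u + c *: t = c *: (t + c^-1 *: u))%R.
    by rewrite scalerDr scalerA divff // scale1r addrC.
  apply/idP/idP => [/memvZ-> //|/(memvZ c^-1)].
  by rewrite scalerK.
(* As 0 lies in [A] and [B], taking [c = 0] in [a + b - c] makes both closed under addition. *)
apply: (no_inverse_closed_sqr q_gt1 hF cA A0) => a b aA bA.
  by rewrite -[(a + b)%R]subr0 AD.
by rewrite -AB invrK -[X in X \in _]subr0 BD ?AB.
Qed.
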